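(* Let $P$ be a finite poset, let $\alpha,\beta:P\to[0,\infty)$ be order-decreasing, and let $$A=VD_\alpha W,\qquad B=\tilde V D_\beta\tilde W$$ be singular value decompositions of matrices in $\mathbb{C}^{P\times P}$ (with $V,W,\tilde V,\tilde W$ unitary). If $V^*\tilde V\in\overline{\mathcal{L}(P)\,\mathcal{U}(P)}$ and $W\tilde W^*\in\overline{\mathcal{L}(P)\,\mathcal{U}(P)}$, then $$\sigma(A+B)\prec_w\lambda(D_{\alpha+\beta})\prec\sigma(A)+\sigma(B),$$ where $D_{\alpha+\beta}$ is the diagonal matrix with diagonal entries $\big(\alpha(x)+\beta(x)\big)_{x\in P}$.
   Context: Matrices in $\mathbb{C}^{P\times P}$ have rows and columns indexed by the finite set $P$. For $f:P\to\mathbb{R}$, $D_f\in\mathbb{C}^{P\times P}$ is the diagonal matrix with diagonal entries $(f(x))_{x\in P}$. A function $f:P\to\mathbb{R}$ on a poset is order-decreasing if $x\le y$ implies $f(x)\ge f(y)$. In the singular value decompositions, the singular values are labeled by $\alpha$ and $\beta$ and need not be listed in decreasing order along any particular enumeration of $P$. For a finite poset $P$, $$\mathcal{L}(P):=\{L\in\mathbb{C}^{P\times P}\mid L_{xy}=0\text{ unless }y\le x\},\qquad \mathcal{U}(P):=\{U\in\mathbb{C}^{P\times P}\mid U_{xy}=0\text{ unless }x\le y\},$$ $\mathcal{L}(P)\,\mathcal{U}(P)=\{LU\mid L\in\mathcal{L}(P),U\in\mathcal{U}(P)\}$, and the bar denotes the closure in the norm topology. $\sigma(X)$ is the vector of singular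 values of $X$ in decreasing order, and $\lambda(X)$ is the vector of eigenvalues of a Hermitian $X$ in decreasing order (both with multiplicity). For $x,y\in\mathbb{R}^d$, weak majorization $x\prec_w y$ means $\sum_{i=1}^k x_i^\downarrow\le\sum_{i=1}^k y_i^\downarrow$ for all $k\in\{1,\dots,d\}$, where $\downarrow$ denotes decreasing rearrangement; majorization $x\prec y$ requires in addition equality for $k=d$. *)

(* Defs.v *)
From HB Require Import structures.
From mathcomp Require Import all_boot all_order all_algebra.
From mathcomp Require Import spectral complex.
From mathcomp Require Import classical_sets reals topology normedtype.

Set Implicit Arguments.
Unset Strict Implicit.
Unset Printing Implicit Defensive.

Import Order.TTheory GRing.Theory Num.Theory.
Import numFieldNormedType.Exports.
Local Open Scope classical_set_scope.
Local Open Scope ring_scope.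
Local Open Scope complex_scope.
Local Open Scope sesquilinear_scope.

(* The topology of the modulus on R[i].  It induces on 'M[R[i]]_(m, n), through
   the library instance for matrices, the topology of the entrywise max norm,
   i.e. the norm topology (all norms being equivalent). *)
HB.instance Definition _ (R : rcfType) := NormedModule.copy R[i] R[i]^o.

(* A matrix indexed by the finite type P is a matrix of size #|P|; the entry
   with labels x, y : P is M (enum_rank x) (enum_rank y). *)
Section PosetMatrices.
Context (R : rcfType) (d : Order.disp_t) (P : finPOrderType d).

Definition order_decreasing (f : P -> R) :=
  forall x y : P, (x <= y)%O -> f y <= f x.

Definition Dmx (f : P -> R) : 'M[R[i]]_#|P| :=
  diag_mx (\row_i (f (enum_val i))%:C).

Definition Lset : set 'M[R[i]]_#|P| :=
  [set L | forall x y : P, ~~ (y <= x)%O -> L (enum_rank x) (enum_rank y) = 0].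

Definition Uset : set 'M[R[i]]_#|P| :=
  [set U | forall x y : P, ~~ (x <= y)%O -> U (enum_rank x) (enum_rank y) = 0].

Definition LUset : set 'M[R[i]]_#|P| :=
  [set L *m U | L in Lset & U in Uset].

End PosetMatrices.

Arguments Dmx {R d P} f.
Arguments Lset R {d} P.
Arguments Uset R {d} P.
Arguments LUset R {d} P.

Section Spectra.
Context (R : rcfType) (n : nat).

Definition eigenvals (X : 'M[R[i]]_n) : seq R[i] :=
  sval (closed_field_poly_normal (char_poly X)).

(* Only meaningful for Hermitian X, whose eigenvalues are real, so that taking
   real parts is just a change of type. *)
Definition lambda (X : 'M[R[i]]_n) : 'rV[R]_n :=
  \row_i (sort >=%R [seq complex.Re z | z <- eigenvals X])`_i.

Definition sigma (X : 'M[R[i]]_n) : 'rV[R]_n :=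
  \row_i Num.sqrt (lambda (X^t* *m X) 0 i).

End Spectra.

Section Majorization.
Context (R : realDomainType) (n : nat).

Definition rearr (x : 'rV[R]_n) : seq R := sort >=%R [seq x 0 i | i : 'I_n].

Definition weak_majorized (x y : 'rV[R]_n) :=
  forall k, (1 <= k <= n)%N ->
    \sum_(0 <= i < k) (rearr x)`_i <= \sum_(0 <= i < k) (rearr y)`_i.

Definition majorized (x y : 'rV[R]_n) :=
  weak_majorized x y /\
  \sum_(0 <= i < n) (rearr x)`_i = \sum_(0 <= i < n) (rearr y)`_i.

End Majorization.

(* Main.v *)
(* Write M' for the adjoint of M.  By Ky Fan's principle, a sum of k largest
   singular values of A + B equals Re tr (E' (A + B) F) for some E and F with
   at most k orthonormal columns (one for each nonzero singular value).  By
   AM-GM this is at most the average, over (Z, X) = (V' E, V' Vt) and (W F, W Wt'), of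
     tr (Z' D_alpha Z) + tr ((X' Z)' D_beta (X' Z)),
   where Z has orthonormal columns and X is a unitary matrix in the closure of
   L(P) U(P).  In the k-th exterior power this trace is
     sum_f alpha(f) |det Z_f|^2 + sum_g beta(g) |det (X' Z)_g|^2,
   and it is at most any m such that alpha(f) + beta(g) <= m whenever the minor
   det X_{f,g} is nonzero: the exterior power of X' is unitary and moves the
   mass of a set S of indices into the neighbourhood of S, so it suffices to
   compare the level sets of m - alpha and beta.
   A nonzero minor of X is a nonzero minor of some nearby L U, so Cauchy-Binet
   gives an injective h below both f and g, and alpha(f) + beta(g) is at most
   (alpha + beta)(h) since alpha and beta are order-decreasing. *)

Require Import Defs.
From HB Require Import structures.
From mathcomp Require Import all_boot all_order all_fingroup all_algebra.
From mathcomp Require Import ring lra.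
From mathcomp Require Import spectral complex.
From mathcomp Require Import classical_sets boolp reals topology normedtype.
Import Order.TTheory GRing.Theory Num.Theory.
Import numFieldNormedType.Exports.

Set Implicit Arguments.
Unset Strict Implicit.
Unset Printing Implicit Defensive.

Local Open Scope classical_set_scope.
Local Open Scope ring_scope.
Local Open Scope sesquilinear_scope.

(** * Cauchy-Binet identities as sums over all maps *)

Section Minors.
Variables (R : comNzRingType) (k n : nat).
Implicit Types (A : 'M[R]_(k, n)) (B : 'M[R]_(n, k)) (f : {ffun 'I_k -> 'I_n}).

(** Multilinearity in the rows of the product: row [i] is a combination of the rows of [B] with
    coefficients [A i j], and [f] records the row chosen for each [i]. *)
Lemma det_mulmx_ffun A B :
  \det (A *m B) =
  \sum_(f : {ffun 'I_k -> 'I_n}) (\prod_i A i (f i)) * \det (rowsub f B).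
Proof.
transitivity (\sum_(s : 'S_k) \sum_(f : {ffun 'I_k -> 'I_n})
   (-1) ^+ s * \prod_i (A i (f i) * B (f i) (s i))).
  apply: eq_bigr => s _; rewrite -big_distrr /=; congr (_ * _).
  rewrite -(bigA_distr_bigA (fun i j => A i j * B j (s i))) /=.
  by apply: eq_bigr => i _; rewrite mxE.
rewrite exchange_big; apply: eq_bigr => f _ /=.
rewrite big_distrr; apply: eq_bigr => s _ /=.
rewrite big_split /= mulrCA; congr (_ * (_ * _)).
by apply: eq_bigr => i _; rewrite mxE.
Qed.

Lemma det_rowsub_perm (s : 'S_k) f B :
  \det (rowsub [ffun i => f (s i)] B) = (-1) ^+ s * \det (rowsub f B).
Proof.
rewrite -det_perm -det_mulmx -row_permE; congr (\det _).
by apply/matrixP=> i j; rewrite !mxE ffunE.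
Qed.

(** Expand [\det (colsub f A)] over permutations [s] and replace [f] by its composite with the
    inverse of [s]. The sign of [s] then occurs twice and cancels, so all k! permutations contribute
    the same sum. *)
Lemma Cauchy_Binet_weighted (phi : {ffun 'I_k -> 'I_n} -> R) A B :
  (forall (s : 'S_k) f, phi [ffun i => f (s i)] = phi f) ->
  \sum_f phi f * \det (colsub f A) * \det (rowsub f B) =
  k`!%:R * \sum_f phi f * (\prod_i A i (f i)) * \det (rowsub f B).
Proof.
move=> phiP.
transitivity (\sum_(s : 'S_k) \sum_f
    phi f * (\prod_i A i (f i)) * \det (rowsub f B)); last first.
  by rewrite sumr_const card_Sn mulr_natl.
under eq_bigr => f _ do rewrite -mulrA mulrCA {1}/determinant mulr_suml.
rewrite exchange_big; apply: eq_bigr => s _ /=.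
pose h (t : 'S_k) f := [ffun i => f (t i)].
have hK t : cancel (h t) (h t^-1%g).
  by move=> f; apply/ffunP=> i; rewrite !ffunE permKV.
rewrite (reindex_inj (can_inj (hK s^-1%g))); apply: eq_bigr => f _ /=.
rewrite phiP det_rowsub_perm odd_permV.
rewrite (_ : \prod_i _ = \prod_i A i (f i)); last first.
  by apply: eq_bigr => i _; rewrite !mxE ffunE permK.
by rewrite mulrCA mulrACA -signr_addb addbb mul1r mulrA.
Qed.

Lemma Cauchy_Binet A B :
  \sum_(f : {ffun 'I_k -> 'I_n}) \det (colsub f A) * \det (rowsub f B) =
  k`!%:R * \det (A *m B).
Proof.
rewrite det_mulmx_ffun.
have := @Cauchy_Binet_weighted (fun=> 1) A B (fun _ _ => erefl).
by under eq_bigr do rewrite mul1r; under [in RHS]eq_bigr do rewrite mul1r.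
Qed.

(** The cofactors along row [l] do not see that row, so they are those of the identity. *)
Lemma det_identity_but_row m (M : 'M[R]_m) l :
  (forall i j, i != l -> M i j = (i == j)%:R) -> \det M = M l l.
Proof.
move=> M1; have cofE j : cofactor M l j = (l == j)%:R.
  transitivity (cofactor (1%:M : 'M[R]_m) l j).
    congr (_ * \det _); apply/matrixP=> i i'.
    by rewrite !mxE M1 // eq_sym neq_lift.
  have /matrixP/(_ j l) := mul_mx_adj (1%:M : 'M[R]_m).
  by rewrite mul1mx det1 !mxE eq_sym.
rewrite (expand_det_row _ l) (bigD1 l) //= big1 => [|j neq_jl].
  by rewrite addr0 cofE eqxx mulr1.
by rewrite cofE eq_sym (negPf neq_jl) mulr0.
Qed.

(** This is the derivative at t = 0 of Cauchy-Binet for A diag(1 + t a) B, whose determinant is det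
    (1 + t A diag(a) B); the right side is k! times the trace of A diag(a) B. *)
Lemma Cauchy_Binet_deriv (a : 'I_n -> R) A B : A *m B = 1%:M ->
  \sum_(f : {ffun 'I_k -> 'I_n})
    (\sum_i a (f i)) * \det (colsub f A) * \det (rowsub f B) =
  k`!%:R * \sum_l \sum_x A l x * a x * B x l.
Proof.
move=> AB1; rewrite Cauchy_Binet_weighted; last first.
  move=> s f; rewrite [RHS](reindex_inj (@perm_inj _ s)).
  by apply: eq_bigr => i _; rewrite ffunE.
congr (_ * _).
under eq_bigr => f _ do rewrite -mulrA big_distrl /=.
rewrite exchange_big; apply: eq_bigr => l _ /=.
(* Scaling only row [l] of [A] by [a] leaves [Al *m B] equal to the identity outside row [l]. *)
pose Al := \matrix_(i, j) (A i j * (if i == l then a j else 1)).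
transitivity (\det (Al *m B)).
  rewrite det_mulmx_ffun; apply: eq_bigr => f _.
  rewrite mulrA; congr (_ * _).
  under [RHS]eq_bigr do rewrite mxE.
  rewrite big_split /= mulrC; congr (_ * _).
  by rewrite -big_mkcond big_pred1_eq.
rewrite (@det_identity_but_row _ _ l) => [|i j /negPf neq_il].
  by rewrite mxE; apply: eq_bigr => x _; rewrite mxE eqxx.
transitivity ((A *m B) i j); last by rewrite AB1 mxE.
by rewrite !mxE; apply: eq_bigr => x _; rewrite mxE neq_il mulr1.
Qed.

End Minors.

(** * Squared minors of an isometry and their transport by a unitary matrix *)

(* The exterior power is modelled by antisymmetric functions on all maps from
   'I_k to 'I_n, so that each k-subset is counted k`! times. *)
Section MinorMass.
Variables (C : numClosedFieldType) (k n : nat).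
Implicit Types (V : 'M[C]_(n, k)) (X : 'M[C]_n).
Local Notation T := {ffun 'I_k -> 'I_n}.

Lemma det_conj m (M : 'M[C]_m) : \det (M ^t*) = (\det M)^*.
Proof. by rewrite det_map_mx det_tr. Qed.

Lemma colsub_adj m (M : 'M[C]_(n, m)) (f : T) :
  colsub f (M ^t*) = (rowsub f M)^t*.
Proof. by apply/matrixP=> i j; rewrite !mxE. Qed.

Lemma sum_normsq_minors V : V^t* *m V = 1%:M ->
  \sum_(f : T) `|\det (rowsub f V)| ^+ 2 = k`!%:R.
Proof.
move=> VV1; have := Cauchy_Binet (V^t*) V; rewrite VV1 det1 mulr1 => <-.
by apply: eq_bigr => f _; rewrite colsub_adj det_conj normCKC.
Qed.

Lemma sum_normsq_minors_deriv V (a : 'I_n -> C) : V^t* *m V = 1%:M ->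
  \sum_(f : T) (\sum_i a (f i)) * `|\det (rowsub f V)| ^+ 2 =
  k`!%:R * \sum_x a x * \sum_i `|V x i| ^+ 2.
Proof.
move=> VV1.
transitivity (k`!%:R * (\sum_l \sum_x V^t* l x * a x * V x l)).
  rewrite -(Cauchy_Binet_deriv _ VV1).
  apply: eq_bigr => f _.
  by rewrite colsub_adj det_conj -mulrA normCKC.
congr (_ * _); rewrite exchange_big; apply: eq_bigr => x _ /=.
rewrite big_distrr; apply: eq_bigr => l _ /=.
by rewrite !mxE normCKC; ring.
Qed.

(** Up to normalization, the compound of [X^t*] is an isometry on antisymmetric functions; it sends
    the part of the minors of [V] living on [S] to a function supported on [N]. Permutation
    invariance of [S] keeps that part antisymmetric. *)
Lemma minor_mass_le X V (S N : pred T) : X \is unitarymx ->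
    (forall (s : 'S_k) (f : T), S [ffun i => f (s i)] = S f) ->
    (forall f g : T, S f -> \det (mxsub f g X) != 0 -> N g) ->
  \sum_(f | S f) `|\det (rowsub f V)| ^+ 2 <=
  \sum_(g | N g) `|\det (rowsub g (X^t* *m V))| ^+ 2.
Proof.
move=> /unitarymxP XX1 Sperm SN; set W := X^t* *m V.
pose v (f : T) := \det (rowsub f V); pose w (f : T) := \det (rowsub f W).
pose c : C := k`!%:R.
have c0 : c != 0 by rewrite pnatr_eq0 -lt0n fact_gt0.
have cR : c^* = c by rewrite conjC_nat.
pose u (f : T) := (S f)%:R * v f.
(* With C the k-th compound matrix of X, [z = C^t* u] where [u] is the
   restriction of [v] to [S]; then <w, z> = <z, z> = <u, u>, and the claim is
   that the norm of [w - z] on [N] is nonnegative. *)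
pose z (g : T) := c^-1 * \sum_(f : T) (\det (mxsub f g X))^* * u f.
have vE (f : T) : \sum_(g : T) \det (mxsub f g X) * w g = c * v f.
  have -> : v f = \det (rowsub f X *m W).
    by rewrite mul_rowsub_mx mulmxA XX1 mul1mx.
  rewrite -Cauchy_Binet; apply: eq_bigr => g _; congr (_ * _).
  by congr (\det _); apply/matrixP=> i j; rewrite !mxE.
have XXf (f f' : T) :
    \sum_(g : T) \det (mxsub f g X) * (\det (mxsub f' g X))^* =
    c * \det (mxsub f f' 1%:M).
  have -> : mxsub f f' 1%:M = rowsub f X *m (rowsub f' X)^t*.
    rewrite -XX1; apply/matrixP=> i j; rewrite !mxE.
    by apply: eq_bigr => l _; rewrite !mxE.
  rewrite -Cauchy_Binet; apply: eq_bigr => g _; congr (_ * _).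
    by congr (\det _); apply/matrixP=> i j; rewrite !mxE.
  by rewrite -det_conj; congr (\det _); apply/matrixP=> i j; rewrite !mxE.
(* Summing against the minors of the identity antisymmetrizes, up to the factor k!, and [u] is
   already antisymmetric. *)
have uE (f : T) : \sum_(f' : T) \det (mxsub f f' 1%:M) * u f' = c * u f.
  transitivity (\sum_(f' : T) (S f')%:R * \det (colsub f' (rowsub f 1%:M)) *
                             \det (rowsub f' V)).
    apply: eq_bigr => f' _; rewrite /u mulrCA mulrA; congr (_ * _ * _).
    by congr (\det _); apply/matrixP=> i j; rewrite !mxE.
  rewrite Cauchy_Binet_weighted => [|s f']; last by rewrite Sperm.
  congr (_ * _); rewrite (bigD1 f) //= [X in _ + X]big1 ?addr0 => [|f' neq].
    by rewrite big1 ?mulr1 // => i _; rewrite !mxE eqxx.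
  case: (pickP (fun i => f i != f' i)) => [i neqi | eqf].
    by rewrite (bigD1 i) //= !mxE (negPf neqi) mul0r mulr0 mul0r.
  case/eqP: neq; apply/ffunP=> i; apply/esym/eqP.
  by have /negbT := eqf i; rewrite negbK.
have wz : \sum_(g : T) w g * (z g)^* = \sum_(f | S f) `|v f| ^+ 2.
  transitivity (c^-1 * \sum_(g : T) \sum_(f : T)
      (\det (mxsub f g X) * w g * (u f)^*)).
    rewrite big_distrr; apply: eq_bigr => g _ /=.
    rewrite /z rmorphM fmorphV /= cR rmorph_sum /= mulrCA.
    congr (_ * _); rewrite big_distrr; apply: eq_bigr => f _ /=.
    by rewrite rmorphM /= conjCK mulrCA mulrA.
  rewrite exchange_big big_distrr [RHS]big_mkcond; apply: eq_bigr => f _ /=.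
  rewrite -big_distrl /= vE !mulrA mulVf // mul1r /u.
  by case: (S f); rewrite ?mul1r ?normCK ?mul0r ?rmorph0 ?mulr0.
have zz : \sum_(g : T) z g * (z g)^* = \sum_(f | S f) `|v f| ^+ 2.
  transitivity (c^-1 * c^-1 * \sum_(f' : T) \sum_(f : T) \sum_(g : T)
      (\det (mxsub f' g X) * (\det (mxsub f g X))^*) * u f * (u f')^*).
    under [in RHS]eq_bigr do rewrite exchange_big.
    rewrite exchange_big big_distrr; apply: eq_bigr => g _ /=.
    rewrite /z rmorphM fmorphV /= cR rmorph_sum /= mulrACA.
    congr (_ * _); rewrite mulrC big_distrl /=; apply: eq_bigr => f _.
    rewrite big_distrr; apply: eq_bigr => f' _ /=.
    by rewrite rmorphM /= conjCK; ring.
  rewrite [RHS]big_mkcond big_distrr; apply: eq_bigr => f' _ /=.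
  under eq_bigr do rewrite -!big_distrl /= XXf -[c * _ * _]mulrA.
  rewrite -big_distrl /=.
  rewrite -big_distrr /= uE.
  rewrite (_ : _ * _ = u f' * (u f')^*); last by field.
  rewrite /u; case: (S f'); rewrite ?mul1r ?normCK //.
  by rewrite !mul0r.
have z0 g : ~~ N g -> z g = 0.
  move=> Ng; rewrite /z big1 ?mulr0 // => f _; rewrite /u.
  case Sf: (S f); last by rewrite mul0r mulr0.
  have [->|/(SN _ _ Sf)] := eqVneq (\det (mxsub f g X)) 0.
    by rewrite rmorph0 mul0r.
  by rewrite (negPf Ng).
have supp (F : T -> C) :
    \sum_(g | N g) F g * (z g)^* = \sum_(g : T) F g * (z g)^*.
  rewrite [RHS](bigID N) /= [X in _ + X]big1 ?addr0 // => g /z0 ->.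
  by rewrite rmorph0 mulr0.
have : 0 <= \sum_(g | N g) `|w g - z g| ^+ 2.
  by apply: sumr_ge0 => g _; rewrite exprn_ge0.
set M := \sum_(f | S f) _ in wz zz *.
have MR : M^* = M.
  rewrite rmorph_sum; apply: eq_bigr => f _.
  by rewrite rmorphXn /= conj_normC.
have -> : \sum_(g | N g) `|w g - z g| ^+ 2 =
    \sum_(g | N g) `|w g| ^+ 2 - \sum_(g | N g) w g * (z g)^*
     - (\sum_(g | N g) w g * (z g)^*)^* + \sum_(g | N g) z g * (z g)^*.
  rewrite rmorph_sum /= -!sumrB -big_split /=; apply: eq_bigr => g _.
  rewrite !normCK; move: (w g) (z g) => p q.
  by rewrite rmorphB rmorphM /= conjCK; ring.
by rewrite !supp wz zz MR subrK subr_ge0.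
Qed.
End MinorMass.

(** * Comparing weighted sums through level sets *)

(** Telescoping: [v] is the least entry plus the gaps above all entries smaller than [v]. *)
Lemma sorted_layer_cake (R : realDomainType) (s : seq R) (v : R) :
  sorted <=%R s -> v \in s ->
  v = s`_0 + \sum_(j < (size s).-1) (s`_j.+1 - s`_j) * (~~ (v <= s`_j))%:R.
Proof.
move=> s_sorted /(nthP 0)[i lt_is <-].
have s_mono j l : (j <= l < size s)%N -> s`_j <= s`_l.
  case/andP=> le_jl lt_l; apply: (sorted_leq_nth le_trans lexx) => //.
  by rewrite inE (leq_ltn_trans le_jl).
rewrite -(big_mkord xpredT
  (fun j => (s`_j.+1 - s`_j) * (~~ (s`_i <= s`_j))%:R)).
have le_i : (i <= (size s).-1)%N by rewrite -ltnS prednK // (leq_trans _ lt_is).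
rewrite (big_cat_nat (leq0n i) le_i) /=.
rewrite [X in _ + (_ + X)]big_nat [X in _ + (_ + X)]big1 ?addr0; last first.
  move=> j /andP[le_ij lt_j]; rewrite s_mono ?mulr0 // le_ij /=.
  by rewrite (leq_trans lt_j) ?leq_pred.
rewrite big_nat (eq_bigr (fun j => s`_j.+1 - s`_j)) => [|j /= lt_ji].
  by rewrite -big_nat telescope_sumr // addrC subrK.
(* If [s_j] is not below [s_i] although j < i, the entries from j to i coincide and the gap is
   zero. *)
case: leP => [le_ij | _]; last by rewrite mulr1.
have : s`_j <= s`_j.+1 by rewrite s_mono // leqnSn (leq_ltn_trans _ lt_is).
have : s`_j.+1 <= s`_i by rewrite s_mono // lt_ji lt_is.
move=> le1 le2; rewrite mulr0; apply/esym/eqP.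
by rewrite subr_eq0 eq_le le2 (le_trans le1).
Qed.

(** Stochastic dominance. Over one list of thresholds containing the values of both [c] and [b],
    each sum is a combination of tail masses with the same nonnegative gaps as coefficients. *)
Lemma ler_sum_stochastic (R : realDomainType) (T U : finType)
    (c p : T -> R) (b q : U -> R) :
    \sum_f p f = \sum_g q g ->
    (forall t, \sum_(f | c f <= t) p f <= \sum_(g | b g <= t) q g) ->
  \sum_g b g * q g <= \sum_f c f * p f.
Proof.
move=> eq_pq le_pq.
pose s := sort <=%R (codom c ++ codom b).
have s_sorted : sorted <=%R s by apply: sort_sorted; apply: le_total.
have layers (I : finType) (h r : I -> R) : {subset codom h <= s} ->
    \sum_i h i * r i = s`_0 * (\sum_i r i) +
    \sum_(j < (size s).-1) (s`_j.+1 - s`_j) *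
       (\sum_i r i - \sum_(i | h i <= s`_j) r i).
  move=> hs; rewrite big_distrr.
  under [X in _ + X]eq_bigr => j _ do
    rewrite [X in _ * (_ - X)]big_mkcond -sumrB big_distrr.
  rewrite exchange_big -big_split; apply: eq_bigr => i _ /=.
  rewrite {1}(sorted_layer_cake s_sorted (hs _ (codom_f h i))).
  rewrite mulrDl big_distrl /=; congr (_ + _); apply: eq_bigr => j _.
  by rewrite -mulrA; case: leP; rewrite ?mul0r ?subrr ?mul1r ?subr0.
have cs : {subset codom c <= s} by move=> x; rewrite mem_sort mem_cat => ->.
have bs : {subset codom b <= s}.
  by move=> x; rewrite mem_sort mem_cat => ->; rewrite orbT.
rewrite (layers _ _ _ bs) (layers _ _ _ cs).
rewrite eq_pq lerD2l; apply: ler_sum => j _; apply: ler_wpM2l.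
  rewrite subr_ge0 (sorted_leq_nth le_trans lexx) //.
  - by rewrite inE (leq_trans (ltn_ord j)) ?leq_pred.
  by rewrite inE -ltn_predRL.
by rewrite lerD2l lerN2.
Qed.

(** * The trace bound from the support of the minors *)

Section TraceBound.
Variables (R : rcfType) (n k : nat).
Local Notation T := {ffun 'I_k -> 'I_n}.

(** Squared modulus with values in [R], so that the estimates take place in the real field. *)
Definition sqnorm (z : R[i]) : R := complex.Re z ^+ 2 + complex.Im z ^+ 2.

Lemma sqnormE (z : R[i]) : (sqnorm z)%:C%C = `|z| ^+ 2.
Proof. exact: add_Re2_Im2. Qed.

Lemma sum_sqnormE (I : finType) (D : pred I) (F : I -> R[i]) :
  (\sum_(i | D i) sqnorm (F i))%:C%C = \sum_(i | D i) `|F i| ^+ 2.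
Proof. by rewrite rmorph_sum; apply: eq_bigr => i _; apply: sqnormE. Qed.

Lemma sum_sqnorm_minors (V : 'M[R[i]]_(n, k)) : V^t* *m V = 1%:M ->
  \sum_(f : T) sqnorm (\det (rowsub f V)) = k`!%:R.
Proof.
move=> VV1; apply: (@complexI R); rewrite sum_sqnormE rmorph_nat.
exact: sum_normsq_minors.
Qed.

Lemma sum_sqnorm_minors_deriv (V : 'M[R[i]]_(n, k)) (a : 'I_n -> R) :
    V^t* *m V = 1%:M ->
  \sum_(f : T) (\sum_i a (f i)) * sqnorm (\det (rowsub f V)) =
  k`!%:R * \sum_x a x * \sum_i sqnorm (V x i).
Proof.
move=> VV1; apply: (@complexI R); rewrite rmorph_sum rmorphM rmorph_nat /=.
transitivity (\sum_(f : T) (\sum_i (a (f i))%:C%C) * `|\det (rowsub f V)| ^+ 2).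
  by apply: eq_bigr => f _; rewrite rmorphM rmorph_sum /= sqnormE.
rewrite (sum_normsq_minors_deriv (fun x => (a x)%:C%C)) //; congr (_ * _).
rewrite rmorph_sum; apply: eq_bigr => x _.
rewrite rmorphM rmorph_sum; congr (_ * _); apply: eq_bigr => i _.
by rewrite /= sqnormE.
Qed.

(** For each t, apply [minor_mass_le] to the sets a(f) >= m - t and b(g) <= t: a nonzero minor gives
    b(g) <= m - a(f) <= t. Hence the mean of b under the squared minors of [X^t* *m V] is at most
    that of m - a under those of [V]; the total mass k! cancels. *)
Lemma trace_bound (a b : 'I_n -> R) (m : R) (X : 'M[R[i]]_n)
    (V : 'M[R[i]]_(n, k)) :
    X \is unitarymx -> V^t* *m V = 1%:M ->
    (forall f g : T, \det (mxsub f g X) != 0 ->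
       \sum_i a (f i) + \sum_i b (g i) <= m) ->
  \sum_x a x * (\sum_i sqnorm (V x i)) +
    \sum_y b y * (\sum_i sqnorm ((X^t* *m V) y i)) <= m.
Proof.
move=> Xu VV1 Xsupp; set W := X^t* *m V.
have WW1 : W^t* *m W = 1%:M.
  rewrite /W trmx_mul map_mxM trmxCK mulmxA -(mulmxA _ X).
  by rewrite (unitarymxP Xu) mulmx1.
pose p (f : T) := sqnorm (\det (rowsub f V)).
pose q (f : T) := sqnorm (\det (rowsub f W)).
have pE : \sum_f p f = k`!%:R := sum_sqnorm_minors VV1.
have qE : \sum_f q f = k`!%:R := sum_sqnorm_minors WW1.
have apE : \sum_(f : T) (\sum_i a (f i)) * p f = _
  := sum_sqnorm_minors_deriv a VV1.
have bqE : \sum_(f : T) (\sum_i b (f i)) * q f = _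
  := sum_sqnorm_minors_deriv b WW1.
have le_pq t : \sum_(f : T | m - \sum_i a (f i) <= t) p f <=
             \sum_(g : T | \sum_i b (g i) <= t) q g.
  rewrite -lecR [leLHS]sum_sqnormE [leRHS]sum_sqnormE.
  apply: minor_mass_le Xu _ _ => [s f | f g].
    congr (_ - _ <= _); rewrite [in RHS](reindex_inj (@perm_inj _ s)).
    by apply: eq_bigr => i _; rewrite ffunE.
  by move=> le_t /Xsupp; rewrite addrC -lerBrDr => /le_trans; apply.
have cpE : \sum_(f : T) (m - \sum_i a (f i)) * p f =
    k`!%:R * (m - \sum_x a x * \sum_i sqnorm (V x i)).
  rewrite mulrBr -apE (mulrC k`!%:R) -pE big_distrr -sumrB.
  by apply: eq_bigr => f _; apply: mulrBl.
have := ler_sum_stochastic (etrans pE (esym qE)) le_pq.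
by rewrite [leRHS]cpE [leLHS]bqE ler_pM2l ?ltr0n ?fact_gt0 // lerBrDr addrC.
Qed.

End TraceBound.

(** * Minors of products LU and of their limits *)

Section PosetMinors.
Variables (R : rcfType) (d : Order.disp_t) (P : finPOrderType d) (k : nat).
Implicit Types (f g h : {ffun 'I_k -> 'I_#|P|}) (X : 'M[R[i]]_#|P|).

(** Some term of the row expansion survives. Its factors from [L] place [h] below [f]; a nonzero
    Leibniz term of the remaining minor of [U] provides [s] and places [h] below [g] composed with
    [s]. A repeated value of [h] would give that minor two equal rows. *)
Lemma LUset_minor X f g : LUset R P X -> \det (mxsub f g X) != 0 ->
  exists h (s : 'S_k), injective h /\
    forall i, (enum_val (h i) <= enum_val (f i))%O /\
              (enum_val (h i) <= enum_val (g (s i)))%O.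
Proof.
case=> L Llow [U Uup <-]; rewrite mxsub_mul det_mulmx_ffun => /eqP minor0.
have [h] : exists h, (\prod_i rowsub f L i (h i)) *
                     \det (rowsub h (colsub g U)) != 0.
  apply/existsP/contraT; rewrite negb_exists => /forallP all0.
  case: minor0; apply: big1 => h _; apply/eqP.
  by have := all0 h; rewrite negbK.
rewrite mulf_eq0 negb_or => /andP[/prodf_neq0 Lneq0 detU].
have [s] : exists s : 'S_k, \prod_i rowsub h (colsub g U) i (s i) != 0.
  apply/existsP/contraT; rewrite negb_exists => /forallP all0.
  case/eqP: detU; apply: big1 => s _.
  by have := all0 s; rewrite negbK => /eqP->; rewrite mulr0.
move=> /prodf_neq0 Uneq0; exists h, s; split=> [i j eqh | i].
  apply/eqP/contraT => neq_ij; case/eqP: detU.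
  by apply: (determinant_alternate neq_ij) => l; rewrite !mxE eqh.
split.
  have := Lneq0 i isT; rewrite !mxE; apply: contraNT => /Llow.
  by rewrite !enum_valK => ->.
have := Uneq0 i isT; rewrite !mxE; apply: contraNT => /Uup.
by rewrite !enum_valK => ->.
Qed.

End PosetMinors.

Section MinorContinuity.
Variables (R : rcfType) (k n : nat).

Lemma continuous_minor (f g : 'I_k -> 'I_n) :
  continuous (fun X : 'M[R[i]]_n => \det (mxsub f g X)).
Proof.
rewrite (_ : (fun _ => _) = fun X : 'M[R[i]]_n =>
    \sum_(s : 'S_k) (-1) ^+ s * \prod_i X (f i) (g (s i))); last first.
  apply/boolp.funext => X; apply: eq_bigr => s _; congr (_ * _).
  by apply: eq_bigr => i _; rewrite mxE.
apply: continuous_big => [|s _]; first exact: add_continuous.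
move=> X; apply: (@continuousM R[i] _ (fun=> (-1) ^+ s)
  (fun X : 'M[R[i]]_n => \prod_i X (f i) (g (s i)))).
  exact: cst_continuous.
move: X; apply: continuous_big => [|i _]; first exact: mul_continuous.
exact: coord_continuous.
Qed.

(** Nonvanishing of a minor is an open condition. *)
Lemma closure_minor (D : set 'M[R[i]]_n) X (f g : 'I_k -> 'I_n) :
    closure D X -> \det (mxsub f g X) != 0 ->
  exists2 Y, D Y & \det (mxsub f g Y) != 0.
Proof.
move=> clDX Xneq0.
have [Y [DY Yneq0]] := clDX _ (cvgr_neq0 _ (@continuous_minor f g X) Xneq0).
by exists Y.
Qed.
End MinorContinuity.

Section ClosureWeight.
Variables (R : rcfType) (d : Order.disp_t) (P : finPOrderType d) (k : nat).

Lemma closure_LUset_minor (alpha beta : P -> R) (X : 'M[R[i]]_#|P|)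
    (f g : {ffun 'I_k -> 'I_#|P|}) :
    order_decreasing alpha -> order_decreasing beta ->
    closure (LUset R P) X -> \det (mxsub f g X) != 0 ->
  exists2 h : 'I_k -> 'I_#|P|, injective h &
    \sum_i alpha (enum_val (f i)) + \sum_i beta (enum_val (g i)) <=
    \sum_i (alpha (enum_val (h i)) + beta (enum_val (h i))).
Proof.
move=> alpha_decr beta_decr clX /(closure_minor clX)[Y /LUset_minor YP].
move=> /YP[h [s [h_inj hP]]]; exists h => //.
rewrite [\sum_i beta _](reindex_inj (@perm_inj _ s)) -big_split /=.
apply: ler_sum => i _; have [le_hf le_hg] := hP i.
by apply: lerD; [apply: alpha_decr | apply: beta_decr].
Qed.

End ClosureWeight.

(** * Decreasing rearrangement and sums of largest entries *)

Section DecreasingSort.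
Variable R : realDomainType.
Implicit Types s t : seq R.

Lemma ge_sort_sorted s : sorted >=%R (sort >=%R s).
Proof. by apply: sort_sorted => x y; apply: le_total. Qed.

Lemma ge_sorted_eq s t : sorted >=%R s -> sorted >=%R t -> perm_eq s t -> s = t.
Proof.
apply: sorted_eq => [y x z /= le_yx le_zy | x y /=].
  exact: le_trans le_zy le_yx.
by move=> /andP[le_yx le_xy]; apply: le_anti; rewrite le_xy le_yx.
Qed.

Lemma ge_sort_perm s t : perm_eq s t -> sort >=%R s = sort >=%R t.
Proof.
move=> st; apply: ge_sorted_eq; rewrite ?ge_sort_sorted //.
by rewrite perm_sort perm_sym perm_sort perm_sym.
Qed.

Lemma ge_sort_map (f : R -> R) s : {homo f : x y / x <= y} ->
  sort >=%R (map f s) = map f (sort >=%R s).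
Proof.
move=> f_mono; apply: ge_sorted_eq; rewrite ?ge_sort_sorted //.
  by apply: homo_sorted (ge_sort_sorted s) => x y /f_mono.
by rewrite perm_sort perm_sym perm_map // perm_sort.
Qed.

Lemma ge_sorted_nth s i j : sorted >=%R s -> (i <= j < size s)%N ->
  s`_j <= s`_i.
Proof.
move=> s_sorted /andP[le_ij lt_j].
apply: (@sorted_leq_nth _ (>=%R) _ _ 0 s s_sorted) => //.
- by move=> y x z /= le_yx le_zy; apply: le_trans le_zy le_yx.
- by move=> x /=.
- by rewrite inE (leq_ltn_trans le_ij).
Qed.

(** Take t to be the k-th largest entry, at index k - 1: the positive parts of x - t vanish beyond
    it. The sum then ranges over all entries, free of positions in the sorted list. *)
Lemma sum_top_threshold s k : (0 < k <= size s)%N ->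
  exists2 t, t \in s & \sum_(0 <= i < k) (sort >=%R s)`_i =
    t *+ k + \sum_(x <- s) Num.max (x - t) 0.
Proof.
case/andP=> k_gt0 le_k; pose s' := sort >=%R s; pose t := s'`_k.-1.
have sz : size s' = size s by rewrite size_sort.
have lt_k : (k.-1 < size s')%N by rewrite sz prednK.
have s'P := ge_sort_sorted s.
exists t; first by rewrite -(mem_sort >=%R) mem_nth.
rewrite -[in RHS](perm_big _ (permEl (perm_sort >=%R s))) -/s' /=.
rewrite [X in _ = _ + X](big_nth 0) sz.
rewrite [X in _ = _ + X](big_cat_nat (leq0n k) le_k) /=.
have -> : \sum_(k <= i < size s) Num.max (s'`_i - t) 0 = 0.
  rewrite big_nat big1 // => i /andP[le_ki lt_i].
  apply/max_idPr; rewrite subr_le0; apply: ge_sorted_nth => //.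
  by rewrite sz lt_i (leq_trans (leq_pred _)).
have -> : \sum_(0 <= i < k) Num.max (s'`_i - t) 0 =
          \sum_(0 <= i < k) (s'`_i - t).
  apply: eq_big_nat => i /andP[_ lt_i].
  apply/max_idPl; rewrite subr_ge0; apply: ge_sorted_nth => //.
  by rewrite lt_k andbT -ltnS prednK.
by rewrite addr0 sumrB sumr_const_nat subn0 addrC subrK.
Qed.

Section TopSums.
Variables (n : nat) (c : 'I_n -> R).

(** Bound each c(h i) by t plus the positive part of c(h i) - t; by injectivity these parts sum to
    at most the total. The remaining m t <= k t holds when m = k, or when c >= 0, since t is a value
    of c. *)
Lemma le_sum_top k m (h : 'I_m -> 'I_n) : injective h -> (0 < k <= n)%N ->
    (m <= k)%N -> (forall x, 0 <= c x) \/ m = k ->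
  \sum_i c (h i) <= \sum_(0 <= i < k) (sort >=%R (codom c))`_i.
Proof.
move=> h_inj le_kn le_mk c_ge0.
have [|t t_in ->] := @sum_top_threshold (codom c) k.
  by rewrite size_codom card_ord.
rewrite big_image /=.
apply: (@le_trans _ _ (\sum_i (t + Num.max (c (h i) - t) 0))).
  by apply: ler_sum => i _; rewrite -lerBlDl le_max lexx.
rewrite big_split /= sumr_const card_ord; apply: lerD.
  case: c_ge0 => [c_ge0 | ->] //; apply: ler_wpMn2l => //.
  by have /codomP[x ->] := t_in.
pose F x := Num.max (c x - t) 0.
rewrite -(big_imset F (in2W h_inj)) /= [leRHS](bigID (mem (h @: 'I_m))) /=.
by rewrite lerDl sumr_ge0 // => x _; rewrite le_max lexx orbT.
Qed.

Lemma sum_top_attained k : (k <= n)%N ->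
  exists2 h : 'I_k -> 'I_n, injective h &
    \sum_(0 <= i < k) (sort >=%R (codom c))`_i = \sum_i c (h i).
Proof.
move=> le_kn; pose e := sort (relpre c >=%R) (enum 'I_n).
have sz_e : size e = n by rewrite size_sort size_enum_ord.
have lt_e (i : 'I_k) : (i < size e)%N by rewrite sz_e (leq_trans (ltn_ord i)).
(* The default, never reached, is built from [i] because ['I_n] may be empty. *)
exists (fun i => nth (widen_ord le_kn i) e i) => [i j | ].
  rewrite (set_nth_default (widen_ord le_kn j)) // => /eqP.
  by rewrite nth_uniq ?sort_uniq ?enum_uniq // => /eqP/val_inj.
rewrite big_mkord; apply: eq_bigr => i _.
by rewrite /codom /image_mem sort_map (nth_map (widen_ord le_kn i)).
Qed.

Lemma sum_top_all : \sum_(0 <= i < n) (sort >=%R (codom c))`_i = \sum_i c i.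
Proof.
transitivity (\sum_(x <- sort >=%R (codom c)) x).
  by rewrite [RHS](big_nth 0) size_sort size_codom card_ord.
by rewrite (perm_big _ (permEl (perm_sort _ _))) big_image.
Qed.

End TopSums.

Definition sorted_row n (c : 'I_n -> R) : 'rV[R]_n :=
  \row_i (sort >=%R (codom c))`_i.

Lemma codom_nth n s : size s = n -> codom (fun i : 'I_n => s`_i) = s.
Proof.
move=> sz_s; rewrite /codom /image_mem.
by rewrite (map_comp (nth 0 s) val) val_enum_ord -sz_s map_nth_iota0 ?take_size.
Qed.

Lemma rearr_sorted n (x : 'rV[R]_n) s : size s = n -> sorted >=%R s ->
  (forall i, x 0 i = s`_i) -> rearr x = s.
Proof.
move=> sz_s s_sorted xE; rewrite /rearr.
have -> : [seq x 0 i | i : 'I_n] = s.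
  by rewrite -[RHS](codom_nth sz_s); apply: eq_codom.
by apply: ge_sorted_eq; rewrite ?ge_sort_sorted // perm_sort.
Qed.

Lemma rearr_sorted_row n (c : 'I_n -> R) :
  rearr (sorted_row c) = sort >=%R (codom c).
Proof.
apply: rearr_sorted; first by rewrite size_sort size_codom card_ord.
  exact: ge_sort_sorted.
by move=> i; rewrite mxE.
Qed.

End DecreasingSort.

(** * Eigenvalues, singular values and singular vectors *)

Lemma char_poly_similar (F : comUnitRingType) n (U D : 'M[F]_n) :
  U \in unitmx -> char_poly (invmx U *m D *m U) = char_poly D.
Proof.
move=> Uunit; pose pU := map_mx polyC U; pose pV := map_mx polyC (invmx U).
have VU : pV *m pU = 1%:M by rewrite -map_mxM mulVmx // map_mx1.
have -> : char_poly (invmx U *m D *m U) = \det (pV *m char_poly_mx D *m pU).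
  rewrite /char_poly /char_poly_mx !map_mxM mulmxBr mulmxBl.
  by rewrite scalar_mxC -(mulmxA 'X%:M) VU mulmx1.
by rewrite !det_mulmx mulrAC -det_mulmx VU det1 mul1r.
Qed.

Section Spectra.
Variables (R : rcfType) (n : nat).
Implicit Types (M U : 'M[R[i]]_n) (c : 'I_n -> R).

(** [Dmx f] is convertible to this with [c] equal to [f] after [enum_val], so the results below
    apply to it directly. *)
Definition realdiag c : 'M[R[i]]_n := diag_mx (\row_i (c i)%:C%C).

Lemma eigenvals_unitary_diag U c : U \is unitarymx ->
  perm_eq (eigenvals (U^t* *m realdiag c *m U)) (codom (fun i => (c i)%:C%C)).
Proof.
move=> Uu; rewrite /eigenvals; case: closed_field_poly_normal => r /=.
rewrite (monicP (char_poly_monic _)) scale1r -invmx_unitary //.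
rewrite char_poly_similar ?unitarymx_unit // => cpE.
apply: prod_XsubC_eq; rewrite -cpE char_poly_trig ?diag_mx_is_trig //.
rewrite big_image /=.
by apply: eq_bigr => i _; rewrite !mxE eqxx mulr1n.
Qed.

Lemma lambda_unitary_diag U c : U \is unitarymx ->
  lambda (U^t* *m realdiag c *m U) = sorted_row c.
Proof.
move=> /(eigenvals_unitary_diag c) eigE; apply/rowP=> i; rewrite !mxE.
congr (_`_i); apply: ge_sort_perm; apply: (perm_trans (perm_map _ eigE)).
by rewrite /codom /image_mem -map_comp.
Qed.

Lemma sigma_unitary_diag M U c : U \is unitarymx ->
    M^t* *m M = U^t* *m realdiag c *m U ->
  sigma M = sorted_row (fun i => Num.sqrt (c i)).
Proof.
move=> Uu MM; apply/rowP=> i; rewrite mxE MM lambda_unitary_diag // !mxE.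
rewrite /codom /image_mem (map_comp (@Num.sqrt R) c).
rewrite [in RHS]ge_sort_map; last by move=> x y; apply: ler_wsqrtr.
have := size_codom c; rewrite card_ord => sz.
by rewrite [RHS](nth_map 0) // size_sort sz.
Qed.

Lemma adj_unitarymx U : U \is unitarymx -> U^t* \is unitarymx.
Proof. by rewrite trmxC_unitary. Qed.

Lemma unitarymx_adj_mul U : U \is unitarymx -> U^t* *m U = 1%:M.
Proof.
by move=> /adj_unitarymx/unitarymxP; rewrite trmxCK.
Qed.

Lemma realdiag_mul c e :
  realdiag c *m realdiag e = realdiag (fun i => c i * e i).
Proof.
rewrite /realdiag mulmx_diag; congr diag_mx; apply/rowP=> i.
by rewrite !mxE rmorphM.
Qed.

Lemma realdiag_adj c : (realdiag c)^t* = realdiag c.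
Proof.
apply/matrixP=> i j; rewrite !mxE eq_sym.
case: eqP => [->|_]; rewrite ?mulr0n ?rmorph0 // !mulr1n.
exact: conjc_real.
Qed.

Lemma sigma_svd (V W M : 'M[R[i]]_n) c :
    V \is unitarymx -> W \is unitarymx -> (forall i, 0 <= c i) ->
    M = V *m realdiag c *m W ->
  sigma M = sorted_row c.
Proof.
move=> Vu Wu c_ge0 ->.
rewrite (@sigma_unitary_diag _ W (fun i => c i * c i)) //.
  congr sorted_row; apply/funext => i.
  by rewrite -expr2 sqrtr_sqr ger0_norm.
rewrite !trmx_mul !map_mxM /= realdiag_adj -realdiag_mul.
move: (V^t*) (unitarymx_adj_mul Vu) => V' V'V.
by rewrite !mulmxA -(mulmxA _ V') V'V mulmx1.
Qed.

Lemma adj_mul_self_diag M : exists U c, [/\ U \is unitarymx,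
  (forall i, 0 <= c i) & M^t* *m M = U^t* *m realdiag c *m U].
Proof.
have herm : M^t* *m M \is hermsymmx.
  apply/is_hermitianmxP; rewrite expr0 scale1r.
  by rewrite trmx_mul map_mxM trmxCK.
set U := spectralmx (M^t* *m M); set s := spectral_diag (M^t* *m M).
have Uu : U \is unitarymx := spectral_unitarymx _.
have /orthomx_spectralP := hermitian_normalmx herm; rewrite -/U -/s => MM.
have s_ge0 i : 0 <= s 0 i.
  (* An eigenvalue of M* M is the squared norm of the image under [M] of its unit eigenvector. *)
  have -> : s 0 i = \sum_j `|(M *m U^t*) j i| ^+ 2.
    transitivity (((M *m U^t*)^t* *m (M *m U^t*)) i i).
      rewrite trmx_mul map_mxM trmxCK mulmxA -(mulmxA U) {}MM.
      rewrite invmx_unitary // !mulmxA (unitarymxP Uu) mul1mx.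
      by rewrite -mulmxA (unitarymxP Uu) mulmx1 !mxE eqxx mulr1n.
    by rewrite !mxE; apply: eq_bigr => j _; rewrite !mxE normCKC.
  by apply: sumr_ge0 => j _; rewrite exprn_ge0.
have sE i : s 0 i = (complex.Re (s 0 i))%:C%C by rewrite RRe_real ?ger0_real.
pose c i := complex.Re (s 0 i).
have cE : realdiag c = diag_mx s.
  by congr diag_mx; apply/rowP=> i; rewrite mxE -sE.
exists U, c; rewrite cE -(invmx_unitary Uu); split => // i.
by rewrite -lecR -sE.
Qed.

(** [F] collects eigenvectors of M* M, and [E] is [M *m F] with its orthogonal columns normalized;
    the selected singular values must be nonzero to be inverted. *)
Lemma singular_vectors M U c k (h : 'I_k -> 'I_n) :
    U \is unitarymx -> (forall i, 0 <= c i) ->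
    M^t* *m M = U^t* *m realdiag c *m U ->
    injective h -> (forall i, c (h i) != 0) ->
  exists E F : 'M[R[i]]_(n, k), [/\ E^t* *m E = 1%:M, F^t* *m F = 1%:M &
    forall i, (E^t* *m M *m F) i i = (Num.sqrt (c (h i)))%:C%C].
Proof.
move=> Uu c_ge0 MM h_inj c_neq0.
pose F : 'M[R[i]]_(n, k) := colsub h (U^t*).
pose Sinv : 'M[R[i]]_k := diag_mx (\row_i (Num.sqrt (c (h i)))^-1%:C%C).
have SinvE : Sinv^t* = Sinv.
  apply/matrixP=> i j; rewrite !mxE eq_sym.
  case: eqP => [->|_]; rewrite ?mulr0n ?rmorph0 // !mulr1n.
  exact: conjc_real.
have FE : F^t* = rowsub h U.
  by apply/matrixP=> i j; rewrite !mxE conjCK.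
pose G := M *m F.
have GG : G^t* *m G = diag_mx (\row_i (c (h i))%:C%C).
  rewrite trmx_mul map_mxM mulmxA -(mulmxA _ (M^t*)) FE mul_rowsub_mx.
  rewrite -mxsub_mul MM !mulmxA (unitarymxP Uu) mul1mx.
  rewrite -mulmxA (unitarymxP Uu) mulmx1.
  by apply/matrixP=> i j; rewrite !mxE (inj_eq h_inj).
have FF1 : F^t* *m F = 1%:M.
  rewrite FE -mxsub_mul (unitarymxP Uu).
  by apply/matrixP=> i j; rewrite !mxE (inj_eq h_inj).
have sqr_neq0 i : Num.sqrt (c (h i)) != 0.
  by rewrite sqrtr_eq0 -ltNge lt_neqAle eq_sym c_neq0 c_ge0.
have sqrK i : Num.sqrt (c (h i)) * Num.sqrt (c (h i)) = c (h i).
  by rewrite -expr2 sqr_sqrtr.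
have EE : (G *m Sinv)^t* = Sinv *m G^t* by rewrite trmx_mul map_mxM SinvE.
exists (G *m Sinv), F; split => // [|i].
  rewrite EE mulmxA -(mulmxA Sinv) GG !mulmx_diag -diag_const_mx.
  congr diag_mx; apply/rowP=> i; rewrite !mxE -!rmorphM -{2}sqrK; apply/congr1.
  by rewrite mulrA mulVf // mul1r divff.
rewrite EE -(mulmxA _ M) -(mulmxA Sinv) GG.
rewrite mulmx_diag !mxE eqxx mulr1n -rmorphM -{2}sqrK.
by rewrite mulrA mulVf // mul1r.
Qed.

End Spectra.

(** * Trace estimates and the two majorizations *)

(** Here [p], [r] come from the left vectors and [q], [s] from the right ones, whereas AM-GM pairs
    [p] with [q] and [r] with [s]. *)
Lemma le_half_sums (R : realFieldType) (p q r s t : R) :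
  p + r <= t -> q + s <= t -> 2^-1 * (p + q) + 2^-1 * (r + s) <= t.
Proof. by lra. Qed.

Lemma ReD (R : rcfType) (z w : R[i]) :
  complex.Re (z + w) = complex.Re z + complex.Re w.
Proof. by case: z w => [? ?] [? ?]. Qed.

(** Entrywise AM-GM, Re (conj(e) f) <= (|e|^2 + |f|^2) / 2, with weights [a]. *)
Lemma Re_trace_le (R : rcfType) n k (a : 'I_n -> R) (E F : 'M[R[i]]_(n, k)) :
    (forall x, 0 <= a x) ->
  \sum_i complex.Re ((E^t* *m realdiag a *m F) i i) <=
  2^-1 * (\sum_x a x * (\sum_i sqnorm (E x i)) +
          \sum_x a x * (\sum_i sqnorm (F x i))).
Proof.
move=> a_ge0.
rewrite -big_split big_distrr /=.
have -> : \sum_i complex.Re ((E^t* *m realdiag a *m F) i i) =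
    \sum_x \sum_i a x * complex.Re ((E x i)^* * F x i)%C.
  rewrite exchange_big; apply: eq_bigr => i _ /=.
  rewrite mxE (big_morph _ (@ReD R) (erefl : complex.Re 0 = 0)).
  apply: eq_bigr => x _; rewrite mul_mx_diag !mxE.
  case: (E x i) (F x i) => [e1 e2] [f1 f2] /=; ring.
apply: ler_sum => x _; rewrite -mulrDr mulrCA -big_distrr ler_wpM2l //=.
rewrite -big_split big_distrr /=; apply: ler_sum => i _.
rewrite /sqnorm; case: (E x i) (F x i) => [e1 e2] [f1 f2] /=.
have := sqr_ge0 (e1 - f1); have := sqr_ge0 (e2 - f2); nra.
Qed.

Section TraceBoundClosure.
Variables (R : rcfType) (d : Order.disp_t) (P : finPOrderType d).
Variables (alpha beta : P -> R).
Hypotheses (alpha_ge0 : forall x, 0 <= alpha x).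
Hypotheses (beta_ge0 : forall x, 0 <= beta x).
Hypotheses (alpha_decr : order_decreasing alpha).
Hypotheses (beta_decr : order_decreasing beta).
Local Notation a := (fun i : 'I_#|P| => alpha (enum_val i)).
Local Notation b := (fun i : 'I_#|P| => beta (enum_val i)).
Local Notation ab :=
  (fun i : 'I_#|P| => alpha (enum_val i) + beta (enum_val i)).

(** The bound m of [trace_bound] is the top-k sum of alpha + beta. Fewer than k columns are allowed,
    as zero singular values get dropped; nonnegativity absorbs the missing terms. *)
Lemma trace_bound_closure k m (X : 'M[R[i]]_#|P|) (V : 'M[R[i]]_(#|P|, m)) :
    (0 < k <= #|P|)%N -> (m <= k)%N ->
    X \is unitarymx -> closure (LUset R P) X -> V^t* *m V = 1%:M ->
  \sum_x a x * (\sum_i sqnorm (V x i)) +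
    \sum_y b y * (\sum_i sqnorm ((X^t* *m V) y i)) <=
  \sum_(0 <= i < k) (sort >=%R (codom ab))`_i.
Proof.
move=> lt_kn le_mk Xu clX VV1; apply: trace_bound => // f g.
case/(closure_LUset_minor alpha_decr beta_decr clX) => h h_inj /le_trans; apply.
by apply: (le_sum_top h_inj) => //; left => x; apply: addr_ge0.
Qed.

End TraceBoundClosure.

Lemma lambda_Dmx (R : rcfType) (d : Order.disp_t) (P : finPOrderType d)
  (f : P -> R) : lambda (Dmx f) = sorted_row (fun i => f (enum_val i)).
Proof.
have one_unitary : (1%:M : 'M[R[i]]_#|P|) \is unitarymx.
  by apply/unitarymxP; rewrite trmx1 map_mx1 mulmx1.
rewrite -(lambda_unitary_diag _ one_unitary).
by rewrite trmx1 map_mx1 mulmx1 mul1mx.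
Qed.

Local Open Scope complex_scope.
Local Open Scope sesquilinear_scope.

Theorem theorem2 (R : realType) (d : Order.disp_t) (P : finPOrderType d)
    (alpha beta : P -> R)
    (alpha_ge0 : forall x, 0 <= alpha x) (beta_ge0 : forall x, 0 <= beta x)
    (alpha_decr : order_decreasing alpha) (beta_decr : order_decreasing beta)
    (A B V W Vt Wt : 'M[R[i]]_#|P|)
    (V_unitary : V \is unitarymx) (W_unitary : W \is unitarymx)
    (Vt_unitary : Vt \is unitarymx) (Wt_unitary : Wt \is unitarymx)
    (A_svd : A = V *m Dmx alpha *m W) (B_svd : B = Vt *m Dmx beta *m Wt)
    (VVt_LU : closure (LUset R P) (V^t* *m Vt))
    (WWt_LU : closure (LUset R P) (W *m Wt^t*)) :
  weak_majorized (sigma (A + B)) (lambda (Dmx (fun x => alpha x + beta x)))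
  /\ majorized (lambda (Dmx (fun x => alpha x + beta x))) (sigma A + sigma B).
Proof.
set a := fun i : 'I_#|P| => alpha (enum_val i).
set b := fun i : 'I_#|P| => beta (enum_val i).
pose ab := fun i : 'I_#|P| => alpha (enum_val i) + beta (enum_val i).
rewrite lambda_Dmx -/ab /majorized /weak_majorized rearr_sorted_row.
have sigA : sigma A = sorted_row a
  := sigma_svd V_unitary W_unitary (fun i => alpha_ge0 (enum_val i)) A_svd.
have sigB : sigma B = sorted_row b
  := sigma_svd Vt_unitary Wt_unitary (fun i => beta_ge0 (enum_val i)) B_svd.
have sz (c : 'I_#|P| -> R) : size (sort >=%R (codom c)) = #|P|.
  by rewrite size_sort size_codom card_ord.
(* A sum of two decreasing lists is decreasing, hence its own rearrangement. *)
pose sAB := [seq (sort >=%R (codom a))`_i + (sort >=%R (codom b))`_i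
            | i <- iota 0 #|P|].
have sABE i : (i < #|P|)%N ->
    sAB`_i = (sort >=%R (codom a))`_i + (sort >=%R (codom b))`_i.
  by move=> lt_i; rewrite (nth_map 0%N) ?size_iota // nth_iota.
have rearrAB : rearr (sigma A + sigma B) = sAB.
  apply: rearr_sorted; first by rewrite size_map size_iota.
    apply/(sortedP 0) => i; rewrite size_map size_iota => lt_i.
    rewrite !sABE ?(ltnW lt_i) //=.
    by apply: lerD; apply: ge_sorted_nth; rewrite ?ge_sort_sorted // leqnSn sz.
  by move=> i; rewrite sigA sigB !mxE sABE.
have sumAB k : (k <= #|P|)%N ->
    \sum_(0 <= i < k) (rearr (sigma A + sigma B))`_i =
    \sum_(0 <= i < k) (sort >=%R (codom a))`_i +
    \sum_(0 <= i < k) (sort >=%R (codom b))`_i.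
  move=> le_k; rewrite rearrAB -big_split; apply: eq_big_nat => i /andP[_ lt_i].
  by rewrite sABE // (leq_trans lt_i).
split; last split.
- move=> k lt_k; have [U [c [Uu c_ge0 MM]]] := adj_mul_self_diag (A + B).
  rewrite (sigma_unitary_diag Uu MM) rearr_sorted_row.
  pose s i := Num.sqrt (c i).
  have le_k : (k <= #|P|)%N by case/andP: lt_k.
  have [h h_inj ->] := sum_top_attained s le_k.
  (* Zero singular values add nothing to the sum and have no normalized left vector, so only the
     others are kept. *)
  pose K := [set i | s (h i) != 0]%SET.
  have le_mk : (#|K| <= k)%N by rewrite -[leqRHS]card_ord max_card.
  pose h' (j : 'I_#|K|) := h (enum_val j).
  have h'_inj : injective h' by move=> i j /h_inj/enum_val_inj.
  have c_neq0 j : c (h' j) != 0.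
    have := enum_valP j; rewrite inE /s; apply: contraNneq => ->.
    by rewrite sqrtr0.
  have [E [F [EE FF EMF]]] := singular_vectors Uu c_ge0 MM h'_inj c_neq0.
  have -> : \sum_i s (h i) = \sum_j complex.Re ((E^t* *m (A + B) *m F) j j).
    rewrite (bigID (mem K)) /= [X in _ + X]big1 ?addr0 => [|i]; last first.
      by rewrite inE negbK => /eqP.
    by rewrite big_enum_val; apply: eq_bigr => j _; rewrite EMF.
  (* In the singular bases of [A] and [B] both matrices become diagonal; the changes of basis from
     [E1] to [E2] and from [F1] to [F2] are adjoints of the two matrices assumed in the closure. *)
  pose E1 := V^t* *m E; pose F1 := W *m F.
  pose E2 := Vt^t* *m E; pose F2 := Wt *m F.
  have E2E : E2 = (V^t* *m Vt)^t* *m E1.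
    rewrite /E1 /E2 trmx_mul map_mxM trmxCK -mulmxA.
    by rewrite (mulmxA V) (unitarymxP V_unitary) mul1mx.
  have F2E : F2 = (W *m Wt^t*)^t* *m F1.
    rewrite /F1 /F2 trmx_mul map_mxM trmxCK -mulmxA.
    by rewrite (mulmxA (W^t*)) (unitarymx_adj_mul W_unitary) mul1mx.
  have EMFE : E^t* *m (A + B) *m F =
      E1^t* *m realdiag a *m F1 + E2^t* *m realdiag b *m F2.
    rewrite /E1 /E2 !trmx_mul !map_mxM !trmxCK A_svd B_svd mulmxDr mulmxDl.
    by rewrite !mulmxA.
  have EE1 : E1^t* *m E1 = 1%:M.
    rewrite /E1 trmx_mul map_mxM trmxCK mulmxA -(mulmxA _ V).
    by rewrite (unitarymxP V_unitary) mulmx1.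
  have FF1 : F1^t* *m F1 = 1%:M.
    rewrite /F1 trmx_mul map_mxM mulmxA -(mulmxA _ _ W).
    by rewrite (unitarymx_adj_mul W_unitary) mulmx1.
  have bndE := trace_bound_closure alpha_ge0 beta_ge0 alpha_decr beta_decr
    lt_k le_mk (mul_unitarymx (adj_unitarymx V_unitary) Vt_unitary) VVt_LU EE1.
  have bndF := trace_bound_closure alpha_ge0 beta_ge0 alpha_decr beta_decr
    lt_k le_mk (mul_unitarymx W_unitary (adj_unitarymx Wt_unitary)) WWt_LU FF1.
  rewrite -E2E in bndE; rewrite -F2E in bndF.
  have trA := Re_trace_le E1 F1 (fun x : 'I_#|P| => alpha_ge0 (enum_val x)).
  have trB := Re_trace_le E2 F2 (fun x : 'I_#|P| => beta_ge0 (enum_val x)).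
  rewrite EMFE; under eq_bigr do rewrite mxE ReD.
  rewrite big_split /=; apply: le_trans (lerD trA trB) _.
  exact: le_half_sums bndE bndF.
- move=> k lt_k; have le_k : (k <= #|P|)%N by case/andP: lt_k.
  rewrite sumAB //; have [h h_inj ->] := sum_top_attained ab le_k.
  (* The k indices with the largest alpha + beta compete in the top-k sums of [a] and of [b]
     separately. *)
  by rewrite big_split; apply: lerD; apply: (le_sum_top h_inj) => //; right.
- rewrite sumAB // -big_split /=.
  by rewrite big_split /= !sum_top_all big_split.
Qed.
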